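(* Let $\Omega\subset\mathbb{R}^3$ be a non-empty, open and convex set, $\rho\in L_2(\Omega;\mathbb{R}^+)$ (extended by zero outside $\Omega$), $P\in\mathbb{R}^{3\times 3}$ a constant (homogeneous) receive coil sensitivity, $\theta\in[0,\pi)$, $G\neq 0$ a gradient strength, $A_1,A_2\in\mathbb{R}$ amplitudes and $\Lambda_1,\Lambda_2\colon\mathbb{R}\to\mathbb{R}$ sinusoidal functions. Put $\bm{e}_\theta=(\cos\theta,\sin\theta,0)^T$, $\bm{e}_\theta^\perp=(-\sin\theta,\cos\theta,0)^T$, $\bm{e}_z=(0,0,1)^T$, and consider the magnetic field $$\bm{H}^\theta(\bm{x},t)=\bigl(A_1\Lambda_1(t)-G\langle\bm{x},\bm{e}_\theta^\perp\rangle\bigr)\bm{e}_\theta^\perp+\bigl(-A_2\Lambda_2(t)+G\langle \bm{x},\bm{e}_z\rangle\bigr)\bm{e}_z,$$ which vanishes on a line parallel to $\bm{e}_\theta$ (the field-free line, FFL). Let the induced signal be $$\bm{s}^\theta(t)=-\mu_0 m P\frac{d}{dt}\int_{\mathbb{R}^3}\rho(\bm{x})\,\mathcal{L}\Bigl(\frac{\lVert\bm{H}^\theta(\bm{x},t)\rVert}{H_{\mathrm{sat}}}\Bigr)\frac{\bm{H}^\theta(\bm{x},t)}{\lVert\bm{H}^\theta(\bm{x},t)\rVert}\,d\bm{x},$$ with constants $\mu_0,m,H_{\mathrm{sat}}>0$, and set $h=H_{\mathrm{sat}}/G$. Let $\mathbf{L}_\theta=\langle\bm{e}_\theta\rangle^\perp$,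 described in the rotated coordinates $(\eta,\xi,z)$ (where $\bm{x}=\eta\bm{e}_\theta+\xi\bm{e}_\theta^\perp+z\bm{e}_z$) as the set of points $\bm{y}=(0,\xi,z)$, and let $X_\theta[\rho](\xi,z)=\int_{\mathbb{R}}\rho(\eta\bm{e}_\theta+\xi\bm{e}_\theta^\perp+z\bm{e}_z)\,d\eta$ be the X-ray projection of $\rho$ in direction $\bm{e}_\theta$. Let $\bm{r}(t)=\bigl(0,\,A_1\Lambda_1(t)/G,\,A_2\Lambda_2(t)/G\bigr)^T$ (in the rotated coordinates) be the trajectory of the intersection point of the FFL with $\mathbf{L}_\theta$ and $\bm{v}(t)=\frac{d}{dt}\bm{r}(t)$. Then $$\bm{s}^\theta(t)=-\mu_0 m P E_\theta\, A_{h,\theta}\bigl[X_\theta[\rho]\bigr]\bigl(\bm{r}(t)\bigr)\,\bm{v}(t),\qquad E_\theta=\begin{pmatrix}\cos\theta&-\sin\theta&0\\ \sin\theta&\cos\theta&0\\0&0&-1\end{pmatrix},$$ where for a function $q$ on $\mathbf{L}_\theta$ and $\bm{r}\in\mathbf{L}_\theta$, $$A_{h,\theta}[q](\bm{r})=\int_{\mathbf{L}_\theta} q(\bm{y})\,\nabla_{\bm{r}}\Bigl(\mathcal{L}\Bigl(\frac{\lVert\bm{r}-\bm{y}\rVert}{h}\Bigr)\frac{\bm{r}-\bm{y}}{\lVert\bm{r}-\bm{y}\rVert}\Bigr)\,d\bm{y}$$ (the MPI Core Operator on the plane $\mathbf{L}_\theta$; the gradient is taken with respect to $\bm{r}$ within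 $\mathbf{L}_\theta$, and the resulting $2\times 2$ matrix acts on the in-plane components $(v_2,v_3)$ of $\bm{v}(t)$, the result being regarded as a vector $(0,\cdot,\cdot)^T\in\mathbb{R}^3$).
   Context: $\mathcal{L}(x)=\coth(x)-1/x$ is the Langevin function (with $\mathcal{L}(0)=0$). $\langle\cdot,\cdot\rangle$ is the standard scalar product. The signal model corresponds to Langevin magnetization $\bm{M}=m\rho\,\mathcal{L}(\lVert\bm{H}\rVert/H_{\mathrm{sat}})\bm{H}/\lVert\bm{H}\rVert$ and Faraday's law with constant coil sensitivity $P$.
   Formalization: The formal theorem additionally assumes that ρ is Lebesgue integrable on ℝ³ (automatic for bounded Ω); for unbounded Ω, ρ in L₂ alone does not make the signal integral exist, e.g. ρ(x) = (1+|x|)^(-2) on Ω = ℝ³. *)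

(* Defs.v *)
From HB Require Import structures.
From mathcomp Require Import all_boot all_order all_algebra.
From mathcomp Require Import all_classical all_reals all_analysis.
Set Implicit Arguments. Unset Strict Implicit. Unset Printing Implicit Defensive.
Import Order.TTheory GRing.Theory Num.Theory.
Import numFieldNormedType.Exports.
Local Open Scope classical_set_scope.
Local Open Scope ring_scope.

Section Defs.
Variable R : realType.

Definition coth (x : R) : R :=
  (expR x + expR (- x)) / (expR x - expR (- x)).
Definition langevin (x : R) : R := if x == 0 then 0 else coth x - x^-1.

Definition vec3 (a b c : R) : 'cV[R]_3 := \col_(i < 3) [:: a; b; c]`_i.
Definition dot3 (u v : 'cV[R]_3) : R := \sum_(i < 3) u i 0 * v i 0.
Definition norm3 (u : 'cV[R]_3) : R := Num.sqrt (dot3 u u).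

Definition e_theta (th : R) : 'cV[R]_3 := vec3 (cos th) (sin th) 0.
Definition e_theta_perp (th : R) : 'cV[R]_3 := vec3 (- sin th) (cos th) 0.
Definition e_z : 'cV[R]_3 := vec3 0 0 1.

Definition convex_set3 (O : set 'cV[R]_3) : Prop :=
  forall x y, O x -> O y -> forall l : R, 0 <= l <= 1 ->
    O (l *: x + (1 - l) *: y).

(* Lebesgue measure on R^3 = (R * R) * R (standard coordinates)
   and on R^2 = R * R (coordinates (xi, z) of the plane L_theta). *)
Definition leb := @lebesgue_measure R.
Definition leb2 := (leb \x leb)%E.
Definition leb3 := (leb2 \x leb)%E.

Definition pt3 (p : (R * R) * R) : 'cV[R]_3 := vec3 p.1.1 p.1.2 p.2.

Definition Hfield (th A1 A2 G : R) (L1 L2 : R -> R) (x : 'cV[R]_3) (t : R)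
  : 'cV[R]_3 :=
  (A1 * L1 t - G * dot3 x (e_theta_perp th)) *: e_theta_perp th
  + (- (A2 * L2 t) + G * dot3 x e_z) *: e_z.

Definition magn_integrand (rho : 'cV[R]_3 -> R) (th A1 A2 G Hsat : R)
  (L1 L2 : R -> R) (t : R) (i : 'I_3) (x : 'cV[R]_3) : R :=
  let H := Hfield th A1 A2 G L1 L2 x t in
  if norm3 H == 0 then 0
  else rho x * langevin (norm3 H / Hsat) * (H i 0 / norm3 H).

Definition magn_int (rho : 'cV[R]_3 -> R) (th A1 A2 G Hsat : R)
  (L1 L2 : R -> R) (i : 'I_3) (t : R) : R :=
  \int[leb3]_(p in setT) magn_integrand rho th A1 A2 G Hsat L1 L2 t i (pt3 p).

Definition xray (rho : 'cV[R]_3 -> R) (th xi z : R) : R :=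
  \int[leb]_(eta in setT)
     rho (eta *: e_theta th + xi *: e_theta_perp th + z *: e_z).

(* In-plane core vector field f(u) = L(|u|/h) u/|u| on R^2, component i
   (with f(0) = 0, its continuous extension). *)
Definition core_field (h : R) (i : 'I_2) (u1 u2 : R) : R :=
  let n := Num.sqrt (u1 ^+ 2 + u2 ^+ 2) in
  if n == 0 then 0 else langevin (n / h) * ([:: u1; u2]`_i / n).

Definition core_jac (h : R) (i j : 'I_2) (u1 u2 : R) : R :=
  if j == 0 :> nat then derive1 (fun s => core_field h i s u2) u1
  else derive1 (fun s => core_field h i u1 s) u2.

(* MPI core operator on L_theta (in coordinates (xi,z)):
   A_h[q](r)_{ij} = int_{L_theta} q(y) (grad_r f(r - y))_{ij} dy,
   with r = (0, r2, r3), y = (0, xi, z). *)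
Definition core_op (h : R) (q : R -> R -> R) (r2 r3 : R) : 'M[R]_2 :=
  \matrix_(i < 2, j < 2)
    \int[leb2]_(y in setT) (q y.1 y.2 * core_jac h i j (r2 - y.1) (r3 - y.2)).

Definition E_theta (th : R) : 'M[R]_3 :=
  \matrix_(i < 3, j < 3)
    nth 0 (nth [::] [:: [:: cos th; - sin th; 0];
                        [:: sin th; cos th; 0];
                        [:: 0; 0; -1]] i) j.

Definition embed_plane (w : 'cV[R]_2) : 'cV[R]_3 := vec3 0 (w 0 0) (w 1 0).

End Defs.

(* Main.v *)
(** In the rotated coordinates the field is G times the vector with components
    r(t) - (xi, z), up to the sign of its last entry. Since the Langevin
    function is odd, the integrand is therefore the density times the plane
    field f(u) = L(|u|/h) u/|u| evaluated at r(t) - (xi, z), also when G < 0.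

    From x <= sinh x <= x cosh x and
    x^3/3 <= x cosh x - sinh x <= (x^3/3) cosh x for x >= 0 one gets that L(x)/x
    is bounded and tends to 1/3 at 0, and that L' is bounded. Hence f is
    differentiable along every differentiable curve, also through the origin,
    with a bounded Jacobian, and one may differentiate under the integral sign.

    It remains to integrate out the coordinate along the field-free line. A
    rotation of the plane by an angle in [0, pi) is a product of three shears,
    and a shear preserves Lebesgue measure by Tonelli's theorem and translation
    invariance; another use of Tonelli's theorem produces the X-ray
    projection. *)
Require Import Defs.
From HB Require Import structures.
From mathcomp Require Import all_boot all_order all_algebra.
From mathcomp Require Import all_classical all_reals all_analysis.
From mathcomp Require Import measurable_realfun ring lra.
Import Order.TTheory GRing.Theory Num.Theory.
Import numFieldNormedType.Exports.
Local Open Scope classical_set_scope.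
Local Open Scope ring_scope.

(** * Hyperbolic functions and bounds for the Langevin function *)

Section langevin_function.
Context {R : realType}.
Implicit Types x : R.

Definition cosh x : R := (expR x + expR (- x)) / 2.
Definition sinh x : R := (expR x - expR (- x)) / 2.

Lemma is_derive_expRN x : is_derive x 1 (fun y => expR (- y)) (- expR (- x)).
Proof.
have -> : (fun y : R => expR (- y)) = expR \o -%R by [].
by apply: is_derive_eq; rewrite mulrC mulN1r.
Qed.

Lemma is_derive_cosh x : is_derive x 1 cosh (sinh x).
Proof.
have H := is_derive_expRN x.
rewrite /cosh /sinh.
have -> : (fun y : R => (expR y + expR (- y)) / 2)
  = 2^-1 \*: (expR + (fun y => expR (- y))).
  by apply/funext => y; rewrite /= mulrC.
by apply: is_derive_eq; rewrite mulrC.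
Qed.

Lemma is_derive_sinh x : is_derive x 1 sinh (cosh x).
Proof.
have H := is_derive_expRN x.
rewrite /cosh /sinh.
have -> : (fun y : R => (expR y - expR (- y)) / 2)
  = 2^-1 \*: (expR - (fun y => expR (- y))).
  by apply/funext => y; rewrite /= mulrC.
by apply: is_derive_eq; rewrite opprK mulrC.
Qed.

Lemma sinh0 : sinh 0 = 0.
Proof. by rewrite /sinh oppr0 subrr mul0r. Qed.

Lemma cosh0 : cosh 0 = 1.
Proof. by rewrite /cosh oppr0 expR0 -[1 + 1]/(2%:R) divff. Qed.

Lemma sinhN x : sinh (- x) = - sinh x.
Proof. by rewrite /sinh opprK -mulNr opprB. Qed.

Lemma coshN x : cosh (- x) = cosh x.
Proof. by rewrite /cosh opprK addrC. Qed.

Lemma coshD_sinh x : cosh x + sinh x = expR x.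
Proof. by rewrite /cosh /sinh; field. Qed.

Lemma coshB_sinh x : cosh x - sinh x = expR (- x).
Proof. by rewrite /cosh /sinh; field. Qed.

Lemma cosh2Bsinh2 x : cosh x ^+ 2 - sinh x ^+ 2 = 1.
Proof. by rewrite subr_sqr coshB_sinh coshD_sinh -expRD addNr expR0. Qed.

Lemma cosh_gt0 x : 0 < cosh x.
Proof. by rewrite /cosh divr_gt0// addr_gt0// expR_gt0. Qed.

Lemma cosh_ge1 x : 1 <= cosh x.
Proof.
have := cosh2Bsinh2 x; have := cosh_gt0 x; have := sqr_ge0 (sinh x).
by nra.
Qed.

(** By the mean value theorem. The inequalities below apply it to a difference of two functions that
    vanishes at 0. *)
Lemma le_derive_ge0 (f df : R -> R) :
  (forall y, is_derive (y : R) (1 : R) f (df y)) -> (forall y, 0 < y -> 0 <= df y) ->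
  forall x, 0 <= x -> f 0 <= f x.
Proof.
move=> fdf df0 x; rewrite le_eqVlt => /predU1P[<-//|x0].
have [|c] := @MVT R f df 0 x x0 (fun y _ => fdf y).
  apply: continuous_subspaceT => y; apply: differentiable_continuous.
  by apply/derivable1_diffP; case: (fdf y).
rewrite in_itv/= => /andP[c0 _]; rewrite subr0 => e.
by rewrite -subr_ge0 e mulr_ge0 ?df0// ltW.
Qed.

Lemma le_sinh x : 0 <= x -> x <= sinh x.
Proof.
move=> x0; rewrite -subr_ge0.
have : (sinh - id) 0 <= (sinh - id) x.
  apply: (@le_derive_ge0 _ (fun y => cosh y - 1)) => // y.
    by have H := is_derive_sinh y; apply: is_derive_eq.
  by rewrite subr_ge0 cosh_ge1.
by rewrite !fctE sinh0 subrr.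
Qed.

Lemma sinh_gt0 x : 0 < x -> 0 < sinh x.
Proof. by move=> x0; exact: lt_le_trans (le_sinh x (ltW x0)). Qed.

Lemma sinh_eq0 x : (sinh x == 0) = (x == 0).
Proof.
apply/idP/idP => [|/eqP->]; last by rewrite sinh0.
apply: contraTT => x0.
have [h|h|e] := ltgtP x 0; last by rewrite e eqxx in x0.
- have : 0 < sinh (- x) by rewrite sinh_gt0// oppr_gt0.
  by rewrite sinhN oppr_gt0 => /lt_eqF->.
- by rewrite gt_eqF// sinh_gt0.
Qed.

(** This function is the numerator of L in [langevinE]; the two cosh terms of its derivative
    cancel. *)
Lemma is_derive_xcosh x :
  is_derive x 1 (fun y => y * cosh y - sinh y) (x * sinh x).
Proof.
have H1 := is_derive_cosh x; have H2 := is_derive_sinh x.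
have -> : (fun y : R => y * cosh y - sinh y) = (id * cosh) - sinh by [].
by apply: is_derive_eq; rewrite /GRing.scale/= ?fctE /GRing.scale/=; ring.
Qed.

(** The difference has derivative y (sinh y - y), nonnegative by [le_sinh]. *)
Lemma xcoshB_sinh_ge x : 0 <= x -> x ^+ 3 / 3 <= x * cosh x - sinh x.
Proof.
move=> x0; rewrite -subr_ge0.
pose f : R -> R := (fun y => y * cosh y - sinh y) - 3^-1 \*: (id ^+ 3).
have : f 0 <= f x.
  apply: (@le_derive_ge0 _ (fun y => y * sinh y - y ^+ 2)) => // y.
    have H := is_derive_xcosh y.
    by apply: is_derive_eq; rewrite /GRing.scale/= ?fctE /GRing.scale/=; field.
  by move=> y0; rewrite expr2 -mulrBr mulr_ge0 ?subr_ge0 ?le_sinh// ltW.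
have fE y : f y = y * cosh y - sinh y - 3^-1 * y ^+ 3 by [].
by rewrite !fE sinh0 mul0r subrr expr0n mulr0 subrr [3^-1 * _]mulrC.
Qed.

Lemma sinh_le_xcosh x : 0 <= x -> sinh x <= x * cosh x.
Proof.
move=> x0; rewrite -subr_ge0; apply: le_trans (xcoshB_sinh_ge x x0).
by rewrite divr_ge0// exprn_ge0.
Qed.

Lemma xcoshB_sinh_le x : 0 <= x -> x * cosh x - sinh x <= x ^+ 3 / 3 * cosh x.
Proof.
move=> x0; rewrite -subr_ge0.
pose f : R -> R :=
  (3^-1 \*: (id ^+ 3)) * cosh - (fun y => y * cosh y - sinh y).
have : f 0 <= f x.
  apply: (@le_derive_ge0 _
    (fun y => y ^+ 2 * cosh y + y ^+ 3 / 3 * sinh y - y * sinh y)) => // y.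
    have H1 := is_derive_xcosh y; have H2 := is_derive_cosh y.
    by apply: is_derive_eq; rewrite /GRing.scale/= ?fctE /GRing.scale/=; field.
  move=> y0.
  (* Grouping the first term with the last leaves y cosh y - sinh y, which is nonnegative. *)
  have -> : y ^+ 2 * cosh y + y ^+ 3 / 3 * sinh y - y * sinh y
    = y * (y * cosh y - sinh y) + y ^+ 3 / 3 * sinh y by ring.
  rewrite addr_ge0// mulr_ge0 ?subr_ge0 ?sinh_le_xcosh ?(ltW y0)//.
  - by rewrite divr_ge0// exprn_ge0// ltW.
  - by rewrite ltW// sinh_gt0.
have fE y : f y = 3^-1 * y ^+ 3 * cosh y - (y * cosh y - sinh y) by [].
by rewrite !fE sinh0 mul0r subrr expr0n mulr0 mul0r subrr [3^-1 * _]mulrC.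
Qed.

Lemma langevinE x : x != 0 ->
  langevin x = (x * cosh x - sinh x) / (x * sinh x).
Proof.
move=> x0; rewrite /langevin (negbTE x0) /coth.
have -> : expR x - expR (- x) = 2 * sinh x by rewrite /sinh; field.
have -> : expR x + expR (- x) = 2 * cosh x by rewrite /cosh; field.
have : sinh x != 0 by rewrite sinh_eq0.
by move=> s0; field; rewrite x0 s0.
Qed.

Lemma langevin0 : langevin 0 = 0 :> R.
Proof. by rewrite /langevin eqxx. Qed.

Lemma langevinN x : langevin (- x) = - langevin x.
Proof.
have [->|x0] := eqVneq x 0; first by rewrite oppr0 langevin0 oppr0.
rewrite !langevinE ?oppr_eq0// sinhN coshN.
have : sinh x != 0 by rewrite sinh_eq0.
by move=> s0; field; rewrite x0 s0.
Qed.

(** The value 1/3 is the limit of L(x)/x at 0, so this is the continuous extension. *)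
Definition langevin_ratio x : R := if x == 0 then 3^-1 else langevin x / x.

Lemma langevin_ratioN x : langevin_ratio (- x) = langevin_ratio x.
Proof.
by rewrite /langevin_ratio oppr_eq0 langevinN invrN mulrNN.
Qed.

Lemma langevin_ratioE x : langevin x = x * langevin_ratio x.
Proof.
rewrite /langevin_ratio; have [->|x0] := eqVneq x 0.
  by rewrite langevin0 mul0r.
by rewrite mulrC divfK.
Qed.

(** Serves as an elimination principle: the bounds below are invariant under x -> -x, so only x >= 0
    needs an argument. *)
Lemma even_ge0P (P : R -> Prop) :
  (forall x, P (- x) -> P x) -> (forall x, 0 <= x -> P x) -> forall x, P x.
Proof.
move=> PN Pge0 x; have [/Pge0//|x0] := leP 0 x.
by apply: PN; apply: Pge0; rewrite oppr_ge0 ltW.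
Qed.

(** The cubic bounds on x cosh x - sinh x are divided by x^2 sinh x. Both outer terms equal 1/3 at
    0, which gives continuity there by squeezing. *)
Lemma langevin_ratio_bounds x :
  (3 * cosh x)^-1 <= langevin_ratio x <= cosh x / 3.
Proof.
elim/even_ge0P : x => [x|x x0]; first by rewrite coshN langevin_ratioN.
rewrite /langevin_ratio; have [->|n0] := eqVneq x 0.
  by rewrite cosh0 mulr1 mul1r lexx.
have {}x0 : 0 < x by rewrite lt_neqAle eq_sym n0.
have s0 := sinh_gt0 x x0; have c0 := cosh_gt0 x.
have h1 := xcoshB_sinh_ge x (ltW x0); have h2 := xcoshB_sinh_le x (ltW x0).
have h3 := le_sinh x (ltW x0); have h4 := sinh_le_xcosh x (ltW x0).
rewrite langevinE//.
have -> : (x * cosh x - sinh x) / (x * sinh x) / x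
  = (x * cosh x - sinh x) / (x ^+ 2 * sinh x).
  by field; rewrite (gt_eqF s0) n0.
have p0 : 0 < x ^+ 2 * sinh x by rewrite mulr_gt0// exprn_gt0.
have d0 : 0 < 3 * cosh x by rewrite mulr_gt0.
apply/andP; split.
  rewrite ler_pdivlMr// mulrC ler_pdivrMr//.
  (* The chain is x^2 sinh x <= x^3 cosh x <= 3 cosh x (x cosh x - sinh x). *)
  apply: (@le_trans _ _ (x ^+ 3 / 3 * (3 * cosh x))).
    have -> : x ^+ 3 / 3 * (3 * cosh x) = x ^+ 2 * (x * cosh x) by field.
    by rewrite ler_wpM2l// exprn_ge0// ltW.
  by rewrite ler_wpM2r// mulr_ge0// ltW.
rewrite ler_pdivrMr//; apply: le_trans h2 _.
have -> : x ^+ 3 / 3 * cosh x = (x ^+ 2 * cosh x / 3) * x by field.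
have -> : cosh x / 3 * (x ^+ 2 * sinh x) = (x ^+ 2 * cosh x / 3) * sinh x.
  by field.
by rewrite ler_wpM2l// divr_ge0// mulr_ge0 ?exprn_ge0// ltW.
Qed.

Lemma continuous_langevin_ratio0 : {for 0, continuous langevin_ratio}.
Proof.
have c : cosh x @[x --> (0:R)] --> (1:R).
  rewrite -cosh0; apply: differentiable_continuous.
  by apply/derivable1_diffP; case: (is_derive_cosh 0).
have e : langevin_ratio 0 = 3^-1 by rewrite /langevin_ratio eqxx.
suff : langevin_ratio x @[x --> (0 : R)] --> (3^-1 : R) by rewrite -[X in _ --> X]e.
apply: (@squeeze_cvgr _ _ _ _ (fun x => (3 * cosh x)^-1) (fun x => cosh x / 3)).
- by apply: nearW => x; exact: langevin_ratio_bounds.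
- have -> : 3^-1 = (3 * 1)^-1 :> R by rewrite mulr1.
  by apply: cvgV; [rewrite mulr1|exact: cvgM (cvg_cst _) c].
- have : cosh x / 3 @[x --> (0 : R)] --> (1 / 3 : R) by exact: cvgM c (cvg_cst _).
  by rewrite div1r.
Qed.

(** The upper bound cosh x / 3 is unbounded, so a global bound needs x cosh x - sinh x <= x^2 sinh x
    instead, again by comparing derivatives. *)
Lemma langevin_ratio_norm_le1 x : `|langevin_ratio x| <= 1.
Proof.
have h := langevin_ratio_bounds x.
have g0 : 0 <= langevin_ratio x.
  case/andP: h => h _; apply: le_trans h.
  by rewrite invr_ge0 mulr_ge0// ltW// cosh_gt0.
rewrite ger0_norm// {g0 h}.
elim/even_ge0P : x => [x|x x0]; first by rewrite langevin_ratioN.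
rewrite /langevin_ratio; have [_|n0] := eqVneq x 0.
  by rewrite invf_le1// ler1n.
have {}x0 : 0 < x by rewrite lt_neqAle eq_sym n0.
have s0 := sinh_gt0 x x0; have c0 := cosh_gt0 x.
rewrite langevinE// ler_pdivrMr// mul1r ler_pdivrMr; last by rewrite mulr_gt0.
rewrite (_ : x * (x * sinh x) = x ^+ 2 * sinh x); last by rewrite mulrA.
rewrite -subr_ge0.
pose f : R -> R := (id ^+ 2) * sinh - (fun y => y * cosh y - sinh y).
have : f 0 <= f x.
  apply: (@le_derive_ge0 _ (fun y => y * sinh y + y ^+ 2 * cosh y)).
  - move=> y; have H1 := is_derive_xcosh y; have H2 := is_derive_sinh y.
    by apply: is_derive_eq; rewrite /GRing.scale/= ?fctE /GRing.scale/=; ring.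
  - move=> y y0; have sy0 := sinh_gt0 y y0; have cy0 := cosh_gt0 y.
    by apply: addr_ge0; apply: mulr_ge0; rewrite ?exprn_ge0// ltW.
  - exact: ltW.
have fE y : f y = y ^+ 2 * sinh y - (y * cosh y - sinh y) by [].
by rewrite !fE sinh0 mul0r subrr mulr0 subrr.
Qed.

Lemma langevin_norm_le1 x : `|langevin x| <= 1.
Proof.
elim/even_ge0P : x => [x|x x0]; first by rewrite langevinN normrN.
have [->|n0] := eqVneq x 0; first by rewrite langevin0 normr0.
have {}x0 : 0 < x by rewrite lt_neqAle eq_sym n0.
have s0 := sinh_gt0 x x0.
rewrite langevinE// ger0_norm; last first.
  apply: divr_ge0; first by rewrite subr_ge0 sinh_le_xcosh// ltW.
  by rewrite ltW// mulr_gt0.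
rewrite ler_pdivrMr; last by rewrite mulr_gt0.
rewrite mul1r -subr_ge0.
(* Both summands are nonnegative, because cosh x - sinh x = exp(-x) <= 1. *)
have -> : x * sinh x - (x * cosh x - sinh x)
  = (sinh x - x) + x * (1 - (cosh x - sinh x)) by ring.
rewrite addr_ge0 ?subr_ge0 ?le_sinh ?(ltW x0)// mulr_ge0 ?subr_ge0 ?(ltW x0)//.
by rewrite coshB_sinh expR_le1 oppr_le0 ltW.
Qed.

(** The derivative of L away from 0. At 0 it evaluates to 0 rather than to L'(0) = 1/3, so the
    lemmas below assume x != 0. *)
Definition dlangevin x : R := x ^- 2 - sinh x ^- 2.

Lemma is_derive_langevin x : x != 0 -> is_derive x 1 (@langevin R) (dlangevin x).
Proof.
move=> x0; have s0 : sinh x != 0 by rewrite sinh_eq0.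
apply: (@near_eq_is_derive _ _ _ (cosh * (fun y => (sinh y)^-1)
   - (fun y : R => y^-1))).
- near=> y.
  have y0 : y != 0 by near: y; exact: open_neq.
  have sy0 : sinh y != 0 by rewrite sinh_eq0.
  rewrite langevinE// !fctE; field; by rewrite y0 sy0.
have H1 := is_derive_cosh x; have H2 := is_derive_sinh x.
have H3 := @is_deriveV R sinh x _ 1 s0 H2.
have H4 := @is_deriveV R id x _ 1 x0 (is_derive_id _ _).
apply: is_derive_eq; rewrite /dlangevin /GRing.scale/=.
have -> : x ^- 2 - sinh x ^- 2
  = x ^- 2 - (cosh x ^+ 2 - sinh x ^+ 2) / sinh x ^+ 2.
  by rewrite cosh2Bsinh2 mul1r.
by field; rewrite s0 x0.
Unshelve. all: by end_near.
Qed.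

(** After clearing denominators the claim is sinh^2 x <= x^2 + x^2 sinh^2 x = (x cosh x)^2. *)
Lemma dlangevin_norm_le1 x : x != 0 -> `|dlangevin x| <= 1.
Proof.
elim/even_ge0P : x => [x|x x0 n0].
  by rewrite oppr_eq0 /dlangevin sinhN !sqrrN.
have {}x0 : 0 < x by rewrite lt_neqAle eq_sym n0.
have s0 := sinh_gt0 x x0.
have x2 : 0 < x ^+ 2 by rewrite exprn_gt0.
have s2 : 0 < sinh x ^+ 2 by rewrite exprn_gt0.
have xs : x ^+ 2 <= sinh x ^+ 2.
  by rewrite ler_sqr ?nnegrE ?(ltW x0) ?(ltW s0)// le_sinh// ltW.
rewrite /dlangevin ger0_norm; last by rewrite subr_ge0 lef_pV2.
have -> : x ^- 2 - sinh x ^- 2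
   = (sinh x ^+ 2 - x ^+ 2) / (x ^+ 2 * sinh x ^+ 2).
  by field; rewrite n0 (gt_eqF s0).
rewrite ler_pdivrMr; last exact: mulr_gt0.
rewrite mul1r lerBlDr.
have -> : x ^+ 2 * sinh x ^+ 2 + x ^+ 2 = (x * cosh x) ^+ 2.
  have e : cosh x ^+ 2 = 1 + sinh x ^+ 2 by rewrite -(cosh2Bsinh2 x) subrK.
  by rewrite (_ : (x * cosh x) ^+ 2 = x ^+ 2 * cosh x ^+ 2); [rewrite e|]; ring.
rewrite ler_sqr ?nnegrE ?(ltW s0) ?sinh_le_xcosh ?(ltW x0)//.
by rewrite mulr_ge0 ?(ltW x0)// ltW// cosh_gt0.
Qed.

End langevin_function.

(** * The Jacobian of the plane field f(u) = L(|u|/h) u/|u| *)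

Section core_field_derivative.
Context {R : realType}.
Implicit Types (h s : R) (u : R -> R).

Definition hypot (a b : R) : R := Num.sqrt (a ^+ 2 + b ^+ 2).

Lemma hypot_ge0 (a b : R) : 0 <= hypot a b.
Proof. exact: sqrtr_ge0. Qed.

Lemma sqr_hypot (a b : R) : hypot a b ^+ 2 = a ^+ 2 + b ^+ 2.
Proof. by rewrite sqr_sqrtr// addr_ge0 ?sqr_ge0. Qed.

Lemma hypot_eq0 (a b : R) : (hypot a b == 0) = (a == 0) && (b == 0).
Proof.
by rewrite -sqrf_eq0 sqr_hypot paddr_eq0 ?sqr_ge0// !sqrf_eq0.
Qed.

Lemma norm_nth2_le_hypot (i : 'I_2) (a b : R) : `|[:: a; b]`_i| <= hypot a b.
Proof.
rewrite -[hypot a b]ger0_norm ?hypot_ge0// -ler_sqr ?nnegrE// !real_normK ?num_real//.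
rewrite sqr_hypot.
by case: i => -[|[|//]] /= _; rewrite ?lerDl ?lerDr sqr_ge0.
Qed.

(** This form has no case distinction at the origin; it is what makes the derivative there
    accessible. *)
Lemma core_fieldE h (i : 'I_2) (a b : R) : h != 0 ->
  core_field h i a b = [:: a; b]`_i / h * langevin_ratio (hypot a b / h).
Proof.
move=> h0; rewrite /core_field -/(hypot a b); case: ifPn => [|n0].
  rewrite hypot_eq0 => /andP[/eqP-> /eqP->].
  by case: i => -[|[|//]] /= _; rewrite !mul0r.
by rewrite langevin_ratioE; field; rewrite h0 n0.
Qed.

Lemma core_field_norm_le1 h (i : 'I_2) (a b : R) : `|core_field h i a b| <= 1.
Proof.
rewrite /core_field -/(hypot a b); case: ifPn => [|n0]; first by rewrite normr0.
have {}n0 : 0 < hypot a b by rewrite lt_neqAle eq_sym n0 hypot_ge0.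
rewrite normrM -[leRHS]mulr1 ler_pM// ?langevin_norm_le1//.
rewrite normrM normfV (gtr0_norm n0) ler_pdivrMr// mul1r.
exact: norm_nth2_le_hypot.
Qed.

(** A radial part, L'(n/h)/h times the projection onto u, plus a tangential part, L(n/h)/n times the
    complementary projection. Both coefficients tend to 1/(3h) at the origin, whence the multiple of
    the identity. *)
Definition core_jacobian h (i j : 'I_2) (a b : R) : R :=
  let n := hypot a b in
  let ab := [:: a; b]`_i * [:: a; b]`_j / n ^+ 2 in
  if n == 0 then (i == j)%:R / (3 * h)
  else dlangevin (n / h) / h * ab + langevin (n / h) / n * ((i == j)%:R - ab).

Lemma core_jacobian_norm_le h (i j : 'I_2) (a b : R) : h != 0 ->
  `|core_jacobian h i j a b| <= 3 / `|h|.
Proof.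
move=> h0; rewrite /core_jacobian; case: ifPn => [_|n0].
  rewrite normrM ger0_norm ?ler0n// normfV normrM ger0_norm// invfM mulrA.
  rewrite ler_wpM2r ?invr_ge0//; apply: (@le_trans _ _ 1); last by rewrite ler1n.
  by rewrite ler_pdivrMr// mul1r ler_nat; case: (i == j).
have {}n0 : 0 < hypot a b by rewrite lt_neqAle eq_sym n0 hypot_ge0.
have ab1 : `|[:: a; b]`_i * [:: a; b]`_j / hypot a b ^+ 2| <= 1.
  rewrite normrM normfV [`|_ ^+ 2|]ger0_norm ?sqr_ge0//.
  rewrite ler_pdivrMr ?exprn_gt0// mul1r normrM expr2.
  by rewrite ler_pM// norm_nth2_le_hypot.
have nh0 : hypot a b / h != 0 by rewrite mulf_neq0 ?invr_eq0// gt_eqF.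
(* The radial part contributes 1/|h|; the tangential one 2/|h|, its second factor being a difference
   of two numbers of modulus at most 1. *)
rewrite (_ : 3 / `|h| = `|h|^-1 * 1 + `|h|^-1 * 2); last first.
  by rewrite -mulrDr mulrC -natr1 addrC.
apply: le_trans (ler_normD _ _) _; apply: lerD.
  rewrite normrM ler_pM// normrM normfV -[leRHS]mul1r ler_wpM2r ?invr_ge0//.
  exact: dlangevin_norm_le1.
rewrite normrM ler_pM//.
  rewrite langevin_ratioE (_ : _ / hypot a b = h^-1 * langevin_ratio (hypot a b / h)).
    rewrite normrM normfV -[leRHS]mulr1 ler_wpM2l ?invr_ge0//.
    exact: langevin_ratio_norm_le1.
  by field; rewrite h0 gt_eqF.
apply: le_trans (ler_normB _ _) _; rewrite -[2]/(1 + 1) lerD//.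
by case: eqP => _; rewrite ?normr1 ?normr0.
Qed.

Lemma is_derive_hypot u1 u2 s (d1 d2 : R) : hypot (u1 s) (u2 s) != 0 ->
  is_derive s (1 : R) u1 d1 -> is_derive s (1 : R) u2 d2 ->
  is_derive s (1 : R) (fun x => hypot (u1 x) (u2 x))
    ((u1 s * d1 + u2 s * d2) / hypot (u1 s) (u2 s)).
Proof.
move=> n0 H1 H2.
have p0 : 0 < (u1 ^+ 2 + u2 ^+ 2) s.
  rewrite fctE -[X in 0 < X](sqr_hypot (u1 s) (u2 s)).
  by rewrite exprn_gt0// lt_neqAle eq_sym n0 hypot_ge0.
have Hs := is_derive1_sqrt p0.
have -> : (fun x => hypot (u1 x) (u2 x)) = Num.sqrt \o (u1 ^+ 2 + u2 ^+ 2) by [].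
apply: is_derive_eq.
have -> : Num.sqrt ((u1 ^+ 2 + u2 ^+ 2) s) = hypot (u1 s) (u2 s) by [].
rewrite /GRing.scale/=; by field.
Qed.

Lemma is_derive_core_field_neq0 h c u1 u2 s (dc d1 d2 : R) :
  h != 0 -> hypot (u1 s) (u2 s) != 0 -> is_derive s (1 : R) c dc ->
  is_derive s (1 : R) u1 d1 -> is_derive s (1 : R) u2 d2 ->
  let n := hypot (u1 s) (u2 s) in
  let dn := (u1 s * d1 + u2 s * d2) / n in
  is_derive s (1 : R)
    (fun x => langevin (hypot (u1 x) (u2 x) / h) * (c x / hypot (u1 x) (u2 x)))
    (dlangevin (n / h) / h * dn * (c s / n)
     + langevin (n / h) * (dc / n - c s * dn / n ^+ 2)).
Proof.
move=> h0 n0 Hc H1 H2 n dn.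
pose N x := hypot (u1 x) (u2 x).
have HN : is_derive s (1 : R) N dn by exact: is_derive_hypot.
have HNV := @is_deriveV R N s _ 1 n0 HN.
have nh0 : (h^-1 \*: N) s != 0.
  by apply: mulf_neq0 => //; rewrite invr_eq0.
have HL := is_derive_langevin _ nh0.
rewrite (_ : (fun x => _) =
   (@langevin R \o (h^-1 \*: N)) * (c * (fun x => (N x)^-1))); last first.
  by apply/funext => x; rewrite [_ / h]mulrC.
apply: is_derive_eq; rewrite /GRing.scale/=.
rewrite (_ : h^-1 *: N s = n / h); last exact: mulrC.
rewrite fctE -[N s]/n; field.
by rewrite n0 h0.
Qed.

(** Stated along a differentiable curve so that it serves both the coordinate lines, which give the
    partial derivatives, and the motion in time. Away from the origin it is the chain rule; at the
    origin a Caratheodory slope function is exhibited. *)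
Lemma is_derive_core_field h (i : 'I_2) u1 u2 s (d1 d2 : R) : h != 0 ->
  is_derive s (1 : R) u1 d1 -> is_derive s (1 : R) u2 d2 ->
  is_derive s (1 : R) (fun x => core_field h i (u1 x) (u2 x))
    (core_jacobian h i ord0 (u1 s) (u2 s) * d1
     + core_jacobian h i ord_max (u1 s) (u2 s) * d2).
Proof.
move=> h0 H1 H2.
pose c x := [:: u1 x; u2 x]`_i.
pose dc := [:: d1; d2]`_i.
have Hc : is_derive s (1 : R) c dc.
  by rewrite /c /dc; case: i {c dc} => -[|[|//]].
have dcE : dc = (i == ord0)%:R * d1 + (i == ord_max)%:R * d2.
  rewrite /dc; case: i {c dc Hc} => -[|[|//]] /= ?;
  by rewrite ?mul0r ?mul1r ?addr0 ?add0r.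
pose N x := hypot (u1 x) (u2 x).
have [n0|n0] := eqVneq (N s) 0.
  rewrite /core_jacobian -/(N s) n0 eqxx.
  have cs0 : c s = 0.
    move/eqP: n0; rewrite hypot_eq0 => /andP[/eqP e1 /eqP e2].
    by rewrite /c e1 e2; case: i {c dc Hc dcE} => -[|[|//]].
  have [/= gc [gcE gcC gcs]] := (is_derive1_caratheodory _ _ _).1 Hc.
  have cNh : N z / h @[z --> s] --> (0 : R).
    have : N z / h @[z --> s] --> N s / h.
      apply: cvgM; last exact: cvg_cst.
      have cu u d : is_derive s (1 : R) u d -> {for s, continuous u}.
        by move=> [D _]; apply: differentiable_continuous; exact/derivable1_diffP.
      have c1 := cu _ _ H1; have c2 := cu _ _ H2.
      apply: continuous_comp; last exact: sqrt_continuous.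
      by apply: cvgD; apply: cvgM.
    by rewrite n0 mul0r.
  apply/is_derive1_caratheodory.
  (* As c vanishes at s, it equals gc z times (z - s); the rest of [core_fieldE] is continuous at s
     and joins the slope. *)
  exists (fun z => gc z / h * langevin_ratio (N z / h)); split.
  - move=> z; rewrite !core_fieldE// -/(N z) -/(c z) -/(c s) cs0 !mul0r subr0.
    have := gcE z; rewrite cs0 subr0 => ->; by ring.
  - apply: cvgM; first by apply: cvgM => //; exact: cvg_cst.
    rewrite /= n0 mul0r; exact: cvg_comp cNh continuous_langevin_ratio0.
  - by rewrite gcs dcE n0 mul0r /langevin_ratio eqxx; field.
rewrite (_ : core_jacobian h i ord0 _ _ * _ + _ = 
   dlangevin (N s / h) / h * ((u1 s * d1 + u2 s * d2) / N s) * (c s / N s)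
     + langevin (N s / h) * (dc / N s
         - c s * ((u1 s * d1 + u2 s * d2) / N s) / N s ^+ 2)); last first.
  rewrite /core_jacobian -/(N s) (negbTE n0) -/(c s) dcE /=.
  by field; rewrite h0 n0.
(* N is continuous at s, so the curve avoids the origin near s and the case distinction disappears
   there. *)
apply: near_eq_is_derive (is_derive_core_field_neq0 h c u1 u2 s dc d1 d2 h0 n0 Hc H1 H2).
have cN : {for s, continuous N}.
  have [D _] := is_derive_hypot _ _ _ _ _ n0 H1 H2.
  by apply: differentiable_continuous; exact/derivable1_diffP.
have /cN nb : \forall y \near N s, y != 0 by exact: open_neq.
near=> x.
have Nx : N x != 0 by near: x.
by rewrite /core_field -/(N x) (negbTE Nx).
Unshelve. all: by end_near.
Qed.

Lemma core_jacE h (i j : 'I_2) (a b : R) : h != 0 ->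
  core_jac h i j a b = core_jacobian h i j a b.
Proof.
move=> h0; rewrite /core_jac; case: ifPn => j0.
  have := @is_derive_core_field h i id (cst b) a 1 0 h0 _ _.
  move=> /(_ (is_derive_id _ _) (is_derive_cst _ _ _)) H.
  rewrite derive1E derive_val mulr1 mulr0 addr0.
  by congr core_jacobian; apply/val_inj/esym/eqP.
have := @is_derive_core_field h i (cst a) id b 0 1 h0 _ _.
move=> /(_ (is_derive_cst _ _ _) (is_derive_id _ _)) H.
rewrite derive1E derive_val mulr1 mulr0 add0r.
by congr core_jacobian; apply/val_inj; case: j j0 => -[|[|//]].
Qed.

End core_field_derivative.

(** * Measurability of the field and of its Jacobian *)

Section core_field_measurable.
Context {R : realType} d (T : measurableType d).
Implicit Types f : T -> R.

Lemma measurable_funV f : measurable_fun setT f ->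
  measurable_fun setT (fun x => (f x)^-1).
Proof.
move=> mf; suff mV : measurable_fun setT (fun y : R => y^-1).
  exact: measurableT_comp.
(* The convention that 0 has inverse 0 allows gluing a constant to a function continuous off 0. *)
rewrite (_ : (fun y : R => y^-1) = (fun y => if y == 0 then 0 else y^-1)); last first.
  by apply/funext => y; case: eqP => // ->; rewrite invr0.
apply: measurable_fun_if => //.
  by apply: measurable_fun_eqr => //; exact: measurable_cst.
rewrite setTI (_ : _ @^-1` _ = [set y : R | y != 0]); last first.
  by apply/seteqP; split => y /=; case: eqP.
apply: open_continuous_measurable_fun; first exact: open_neq.
by move=> y; rewrite inE => /= y0; apply: continuousV => //; exact: cvg_id.
Qed.

Lemma measurable_langevin f : measurable_fun setT f ->
  measurable_fun setT (fun x => langevin (f x)).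
Proof.
move=> mf; rewrite /langevin /coth; apply: measurable_fun_ifT.
- by apply: measurable_fun_eqr => //; exact: measurable_cst.
- exact: measurable_cst.
have mfN : measurable_fun setT (fun x => - f x) by exact: measurable_funN.
apply: measurable_funB; last exact: measurable_funV.
apply: measurable_funM; first apply: measurable_funD;
  last apply: measurable_funV; last apply: measurable_funB;
  by apply: measurableT_comp => //; exact: measurable_expR.
Qed.

Lemma measurable_dlangevin f : measurable_fun setT f ->
  measurable_fun setT (fun x => dlangevin (f x)).
Proof.
move=> mf; rewrite /dlangevin /sinh.
have mfN : measurable_fun setT (fun x => - f x) by exact: measurable_funN.
apply: measurable_funB; apply: measurable_funV; apply: measurable_funX => //.
apply: measurable_funM; last exact: measurable_cst.
by apply: measurable_funB; apply: measurableT_comp => //; exact: measurable_expR.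
Qed.

Variables (u1 u2 : T -> R).
Hypotheses (mu1 : measurable_fun setT u1) (mu2 : measurable_fun setT u2).

Lemma measurable_hypot : measurable_fun setT (fun x => hypot (u1 x) (u2 x)).
Proof.
rewrite /hypot; apply: (measurableT_comp (f := @Num.sqrt R)).
  by apply: continuous_measurable_fun; exact: sqrt_continuous.
by apply: measurable_funD; exact: measurable_funX.
Qed.

Lemma measurable_nth2 (i : 'I_2) : measurable_fun setT (fun x => [:: u1 x; u2 x]`_i).
Proof. by case: i => -[|[|//]]. Qed.

Lemma measurable_core_field (h : R) (i : 'I_2) :
  measurable_fun setT (fun x => core_field h i (u1 x) (u2 x)).
Proof.
rewrite /core_field -/(hypot _ _); have mn := measurable_hypot.
apply: measurable_fun_ifT; last apply: measurable_funM.
- by apply: measurable_fun_eqr => //; exact: measurable_cst.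
- exact: measurable_cst.
- apply: measurable_langevin; apply: measurable_funM => //; exact: measurable_cst.
- by apply: measurable_funM; [exact: measurable_nth2|exact: measurable_funV].
Qed.

Lemma measurable_core_jacobian (h : R) (i j : 'I_2) :
  measurable_fun setT (fun x => core_jacobian h i j (u1 x) (u2 x)).
Proof.
have mn := measurable_hypot.
have mnh : measurable_fun setT (fun x => hypot (u1 x) (u2 x) / h).
  by apply: measurable_funM => //; exact: measurable_cst.
have mab : measurable_fun setT (fun x =>
    [:: u1 x; u2 x]`_i * [:: u1 x; u2 x]`_j / hypot (u1 x) (u2 x) ^+ 2).
  apply: measurable_funM; first by apply: measurable_funM; exact: measurable_nth2.
  by apply: measurable_funV; exact: measurable_funX.
rewrite /core_jacobian; apply: measurable_fun_ifT.
- by apply: measurable_fun_eqr => //; exact: measurable_cst.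
- exact: measurable_cst.
apply: measurable_funD; apply: measurable_funM => //.
- by apply: measurable_funM; [exact: measurable_dlangevin|exact: measurable_cst].
- by apply: measurable_funM; [exact: measurable_langevin|exact: measurable_funV].
- by apply: measurable_funB => //; exact: measurable_cst.
Qed.

End core_field_measurable.

(** * Invariance of plane Lebesgue measure under rotations *)

Section plane_rotation.
Context {R : realType}.
Local Open Scope ereal_scope.
Local Notation mu := (@lebesgue_measure R).
Local Notation mu2 := (mu \x mu).
Implicit Types (f : R * R -> \bar R) (a c s t : R).

(** By uniqueness of Lebesgue measure it suffices to compare half-open intervals, whose preimages
    are shifted by -c. *)
Lemma lebesgue_measure_translation c (A : set R) : measurable A ->
  pushforward mu (fun x : R => (x + c)%R : measurableTypeR R) A = mu A.
Proof.
move=> mA.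
have mt : measurable_fun setT (fun x : R => (x + c)%R : measurableTypeR R).
  by apply: measurable_funD => //; exact: measurable_cst.
pose nu := pushforward mu (fun x : R => (x + c)%R : measurableTypeR R).
apply/esym/(@lebesgue_measure_unique R nu) => //= _ [[u v]] _ <-.
rewrite /nu /pushforward (_ : _ @^-1` _ = `](u - c)%R, (v - c)%R]%classic); last first.
  by apply/seteqP; split => x /=; rewrite !in_itv/= ltrBlDr lerBrDr.
rewrite !lebesgue_measure_itv/= !lte_fin ltrD2r; case: ifP => // _.
by rewrite -!EFinB; congr EFin; ring.
Qed.

Lemma ge0_integral_translation (f : R -> \bar R) c :
  measurable_fun setT f -> (forall x, 0 <= f x) ->
  \int[mu]_x f (x + c)%R = \int[mu]_x f x.
Proof.
move=> mf f0.
have mt : measurable_fun setT (fun x : R => (x + c)%R : measurableTypeR R).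
  by apply: measurable_funD => //; exact: measurable_cst.
transitivity
  (\int[pushforward mu (fun x : R => (x + c)%R : measurableTypeR R)]_x f x).
  by rewrite ge0_integral_pushforward.
by apply: eq_measure_integral => A mA _; exact: lebesgue_measure_translation.
Qed.

Lemma measurable_shear1 a :
  measurable_fun setT (fun p : R * R => (p.1 + a * p.2, p.2)%R).
Proof.
apply: measurable_fun_pair => //; apply: measurable_funD => //.
by apply: measurable_funM => //; exact: measurable_cst.
Qed.

Lemma measurable_shear2 a :
  measurable_fun setT (fun p : R * R => (p.1, p.2 + a * p.1)%R).
Proof.
apply: measurable_fun_pair => //; apply: measurable_funD => //.
by apply: measurable_funM => //; exact: measurable_cst.
Qed.

Lemma lebesgue_tonelli1 f : measurable_fun setT f -> (forall p, 0 <= f p) ->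
  \int[mu2]_p f p = \int[mu]_x \int[mu]_y f (x, y).
Proof. exact: (@fubini_tonelli1 _ _ _ _ R mu mu f). Qed.

Lemma lebesgue_tonelli2 f : measurable_fun setT f -> (forall p, 0 <= f p) ->
  \int[mu2]_p f p = \int[mu]_y \int[mu]_x f (x, y).
Proof. exact: (@fubini_tonelli2 _ _ _ _ R mu mu f). Qed.

(** With the second coordinate fixed, the shear is a translation of the inner variable. *)
Lemma ge0_integral_shear1 f a : measurable_fun setT f -> (forall p, 0 <= f p) ->
  \int[mu2]_p f (p.1 + a * p.2, p.2)%R = \int[mu2]_p f p.
Proof.
move=> mf f0; rewrite [RHS]lebesgue_tonelli2//.
pose g (p : R * R) := f (p.1 + a * p.2, p.2)%R.
have mg : measurable_fun setT g.
  by apply: measurableT_comp => //; exact: measurable_shear1.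
rewrite [LHS](lebesgue_tonelli2 g mg (fun p => f0 _)); apply: eq_integral => y _.
rewrite /g/= (ge0_integral_translation (fun x => f (x, y)) (a * y)%R)//.
exact: measurableT_comp.
Qed.

Lemma ge0_integral_shear2 f a : measurable_fun setT f -> (forall p, 0 <= f p) ->
  \int[mu2]_p f (p.1, p.2 + a * p.1)%R = \int[mu2]_p f p.
Proof.
move=> mf f0; rewrite [RHS]lebesgue_tonelli1//.
pose g (p : R * R) := f (p.1, p.2 + a * p.1)%R.
have mg : measurable_fun setT g.
  by apply: measurableT_comp => //; exact: measurable_shear2.
rewrite [LHS](lebesgue_tonelli1 g mg (fun p => f0 _)); apply: eq_integral => x _.
rewrite /g/= (ge0_integral_translation (fun y => f (x, y)) (a * x)%R)//.
exact: measurableT_comp.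
Qed.

(* A rotation is a product of three shears, with t the tangent of the
   half-angle. *)
Lemma ge0_integral_rotation f c s t : (s * t = 1 - c)%R -> (t * (1 + c) = s)%R ->
  measurable_fun setT f -> (forall p, 0 <= f p) ->
  \int[mu2]_p f (c * p.1 - s * p.2, s * p.1 + c * p.2)%R = \int[mu2]_p f p.
Proof.
move=> e1 e2 mf f0.
pose f1 p := f (p.1 + - t * p.2, p.2)%R.
pose f2 p := f1 (p.1, p.2 + s * p.1)%R.
have mf1 : measurable_fun setT f1.
  by apply: measurableT_comp => //; exact: measurable_shear1.
have mf2 : measurable_fun setT f2.
  by apply: measurableT_comp => //; exact: measurable_shear2.
rewrite -(ge0_integral_shear1 f (- t)%R)// -(ge0_integral_shear2 f1 s mf1 (fun p => f0 _)).
rewrite -(ge0_integral_shear1 f2 (- t)%R mf2 (fun p => f0 _)).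
apply: eq_integral => p _; rewrite /f2 /f1/=; congr f.
have ec : c = (1 - s * t)%R by rewrite e1; ring.
have es : (t * c = s - t)%R by rewrite -[in RHS]e2; ring.
congr pair.
  transitivity ((1 - s * t) * p.1 - (t * c + t) * p.2)%R; last by rewrite ec; ring.
  by rewrite es -ec subrK.
by rewrite ec; ring.
Qed.

End plane_rotation.

(** * Tonelli's theorem on a threefold product *)

Section iterated_product.
Local Open Scope ereal_scope.
Context {d1 d2 d3} {T1 : measurableType d1} {T2 : measurableType d2}
  {T3 : measurableType d3} {R : realType}.
Variables (m1 : {sigma_finite_measure set T1 -> \bar R})
  (m2 : {sigma_finite_measure set T2 -> \bar R})
  (m3 : {sigma_finite_measure set T3 -> \bar R}).

(** The rectangles built from two exhaustions are enumerated by coding pairs of indices; a number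
    that codes no pair yields the empty set. *)
Lemma sigma_finite_product_measure : sigma_finite setT (m1 \x m2).
Proof.
have [F UF mF] := sigma_finiteT m1; have [G UG mG] := sigma_finiteT m2.
exists (fun n => if unpickle n is Some ij then F ij.1 `*` G ij.2 else set0).
  apply/esym/seteqP; split => // -[x y] _.
  have [i _ Fx] : (\bigcup_i F i) x by rewrite -UF.
  have [j _ Gy] : (\bigcup_j G j) y by rewrite -UG.
  by exists (pickle (i, j)) => //; rewrite pickleK.
move=> n; case: unpickle => [[i j]|]; last first.
  by split => //; rewrite measure0 ltry.
have [mFi Fi] := mF i; have [mGj Gj] := mG j.
split; first exact: measurableX.
by rewrite /= product_measure1E// lte_mul_pinfty// ge0_fin_numE.
Qed.

(* The sigma-finite instance of a product measure is not found by unification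
   (it is shadowed by the one for subprobabilities), hence the packing. *)
Lemma iterated_tonelli2 (f : (T1 * T2) * T3 -> \bar R) :
  measurable_fun setT f -> (forall p, 0 <= f p) ->
  \int[(m1 \x m2) \x m3]_p f p = \int[m3]_z \int[m1 \x m2]_q f (q, z).
Proof.
move=> mf f0.
pose sf := Measure_isSigmaFinite.Build _ _ _ (m1 \x m2)
  sigma_finite_product_measure.
pose m12 : {sigma_finite_measure set (T1 * T2)%type -> \bar R} :=
  HB.pack (m1 \x m2) sf.
exact: (@fubini_tonelli2 _ _ _ _ R m12 m3 f mf f0).
Qed.

End iterated_product.

(** * Integrating out the direction of the field-free line *)

Section xray_projection.
Context {R : realType}.
Local Notation mu := (@lebesgue_measure R).
Local Notation mu2 := (mu \x mu)%E.
Local Notation mu3 := (mu2 \x mu)%E.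
Variables (rho : 'cV[R]_3 -> R) (th : R).
Hypothesis rho_ge0 : forall x, 0 <= rho x.
Hypothesis mrho : measurable_fun setT (fun p : (R * R) * R => rho (pt3 p)).
Hypothesis th0pi : 0 <= th < pi.

(** The coordinates (xi, z) of the orthogonal projection onto the plane. *)
Definition plane_coord (p : (R * R) * R) : R * R :=
  (- sin th * p.1.1 + cos th * p.1.2, p.2).

Definition of_rotated_coord (q : (R * R) * R) : (R * R) * R :=
  ((cos th * q.1.1 - sin th * q.1.2, sin th * q.1.1 + cos th * q.1.2), q.2).

(** The X-ray projection with extended real values, the setting of Tonelli's theorem. [xray] is its
    [fine] and differs from it exactly where the line integral is infinite. *)
Definition exray (y : R * R) : \bar R :=
  (\int[mu]_eta (rho (pt3 (of_rotated_coord ((eta, y.1), y.2))))%:E)%E.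

Lemma measurable_plane_coord : measurable_fun setT plane_coord.
Proof.
have m11 : measurable_fun setT (fun p : (R * R) * R => p.1.1).
  exact: measurableT_comp.
have m12 : measurable_fun setT (fun p : (R * R) * R => p.1.2).
  exact: measurableT_comp.
apply: measurable_fun_pair => //.
by apply: measurable_funD; apply: measurable_funM => //; exact: measurable_cst.
Qed.

Lemma measurable_of_rotated_coord : measurable_fun setT of_rotated_coord.
Proof.
have m11 : measurable_fun setT (fun p : (R * R) * R => p.1.1).
  exact: measurableT_comp.
have m12 : measurable_fun setT (fun p : (R * R) * R => p.1.2).
  exact: measurableT_comp.
apply: measurable_fun_pair => //; apply: measurable_fun_pair.
  by apply: measurable_funB; apply: measurable_funM => //; exact: measurable_cst.
by apply: measurable_funD; apply: measurable_funM => //; exact: measurable_cst.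
Qed.

Lemma plane_coord_of_rotated q :
  plane_coord (of_rotated_coord q) = (q.1.2, q.2).
Proof.
rewrite /plane_coord /=; congr pair.
transitivity ((cos th ^+ 2 + sin th ^+ 2) * q.1.2); first by ring.
by rewrite cos2Dsin2 mul1r.
Qed.

Lemma xrayE (y : R * R) : xray rho th y.1 y.2 = fine (exray y).
Proof.
rewrite /xray /Rintegral /exray; congr fine; apply: eq_integral => eta _.
congr (rho _)%:E; apply/colP => i; rewrite !mxE/=.
by case: i => -[|[|[|//]]] /= _; ring.
Qed.

(** The witness is tan(th/2). It exists since th/2 lies in [0, pi/2), where the cosine is
    positive. *)
Lemma half_angle_tangent : exists t : R,
  sin th * t = 1 - cos th /\ t * (1 + cos th) = sin th.
Proof.
have c0 : cos (th / 2) != 0.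
  rewrite gt_eqF// cos_gt0_pihalf//; move: th0pi => /andP[t0 tpi].
  have p0 := @pi_gt0 R; apply/andP; split; lra.
have e : cos (th / 2) ^+ 2 + sin (th / 2) ^+ 2 = 1 := cos2Dsin2 _.
have thE : th = th / 2 + th / 2 by field.
exists (sin (th / 2) / cos (th / 2)).
rewrite [in sin th]thE [in cos th]thE sinD cosD.
move: (sin _) (cos _) c0 e => S C C0 e.
(* Homogenizing turns both claims into rational identities in C and S. *)
have -> : 1 = C ^+ 2 + S ^+ 2 by [].
by split; field.
Qed.

Let mrhoE : measurable_fun setT (fun p : (R * R) * R => (rho (pt3 p))%:E).
Proof. exact/measurable_EFinP. Qed.

Lemma measurable_exray : measurable_fun setT exray.
Proof.
(* The plane coordinates come first and eta last, since the variable integrated out has to be the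
   second factor. *)
pose K (q : (R * R) * R) : \bar R :=
  (rho (pt3 (of_rotated_coord ((q.2, q.1.1), q.1.2))))%:E.
apply: (@measurable_fun_fubini_tonelli_F _ _ _ _ R mu K).
- apply: (measurableT_comp mrhoE); apply: measurableT_comp.
    exact: measurable_of_rotated_coord.
  apply: measurable_fun_pair; first apply: measurable_fun_pair => //.
  + exact: measurableT_comp.
  + exact: measurableT_comp.
- by move=> q; rewrite lee_fin.
Qed.

Lemma exray_ge0 y : (0 <= exray y)%E.
Proof. by apply: integral_ge0 => eta _; rewrite lee_fin. Qed.

(** At each height z the horizontal plane is rotated. Then g depends on (xi, z) only and leaves the
    integral over eta. *)
Lemma ge0_integral_exray (g : R * R -> \bar R) :
  measurable_fun setT g -> (forall y, 0 <= g y)%E ->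
  (\int[mu3]_p ((rho (pt3 p))%:E * g (plane_coord p)) =
   \int[mu2]_y (exray y * g y))%E.
Proof.
move=> mg g0.
pose F (p : (R * R) * R) : \bar R := ((rho (pt3 p))%:E * g (plane_coord p))%E.
have mF : measurable_fun setT F.
  apply: emeasurable_funM => //; apply: measurableT_comp => //.
  exact: measurable_plane_coord.
have F0 p : (0 <= F p)%E by rewrite mule_ge0// lee_fin.
rewrite [LHS](@iterated_tonelli2 _ _ _ _ _ _ R mu mu mu F mF F0).
have mX : measurable_fun setT (fun y : R * R => exray y * g y)%E.
  by apply: emeasurable_funM => //; exact: measurable_exray.
rewrite [RHS]lebesgue_tonelli2//; last first.
  by move=> y; rewrite mule_ge0// exray_ge0.
apply: eq_integral => z _; 
have [t [t1 t2]] := half_angle_tangent.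
pose Fz (q : R * R) := F (q, z).
have mFz : measurable_fun setT Fz by exact: measurableT_comp.
rewrite -[LHS](ge0_integral_rotation Fz _ _ _ t1 t2 mFz (fun q => F0 _)).
pose K (q : R * R) : \bar R :=
  ((rho (pt3 (of_rotated_coord (q, z))))%:E * g (q.2, z))%E.
have mK1 : measurable_fun setT
    (fun q : R * R => (rho (pt3 (of_rotated_coord (q, z))))%:E).
  apply: (measurableT_comp mrhoE).
  apply: (measurableT_comp measurable_of_rotated_coord).
  exact: measurable_pair2.
have mK : measurable_fun setT K.
  apply: emeasurable_funM => //; apply: measurableT_comp => //.
  by apply: measurable_fun_pair.
transitivity (\int[mu2]_q K q)%E.
  apply: eq_integral => q _; rewrite /Fz /F /K.
  by rewrite -[X in plane_coord X]/(of_rotated_coord (q, z)) plane_coord_of_rotated.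
rewrite [LHS](lebesgue_tonelli2 K mK); last first.
  by move=> q; rewrite mule_ge0// lee_fin.
apply: eq_integral => xi _; rewrite /K /exray/= ge0_integralZr//.
- by apply: (measurableT_comp mK1); exact: measurable_pair2.
- by move=> eta _; rewrite lee_fin.
Qed.

Hypothesis irho : mu3.-integrable setT (fun p => (rho (pt3 p))%:E).

(** The case g = 1 of [ge0_integral_exray] shows that the projection is integrable, hence finite
    almost everywhere. *)
Lemma exray_ae_fine : ae_eq mu2 setT exray (EFin \o (fine \o exray)).
Proof.
have : mu2.-integrable setT exray.
  apply/integrableP; split; first exact: measurable_exray.
  under eq_integral do rewrite gee0_abs ?exray_ge0// -[exray _]mule1.
  rewrite -(ge0_integral_exray (cst 1%E))//.
  move/integrableP : irho => [_]; under eq_integral do rewrite gee0_abs ?lee_fin//.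
  by under [in X in _ -> X]eq_integral do rewrite mule1.
move/integrable_ae => /(_ measurableT); apply: filterS => y /= /(_ I) yfin _.
by rewrite fineK.
Qed.

(** As the density and its projection are nonnegative, the positive and negative parts of the
    products are the products with those of g, which reduces the claim to nonnegative functions. *)
Lemma Rintegral_xray (g : R * R -> R) : measurable_fun setT g ->
  \int[mu3]_p (rho (pt3 p) * g (plane_coord p)) =
  \int[mu2]_y (xray rho th y.1 y.2 * g y).
Proof.
move=> mg; rewrite /Rintegral; congr fine.
have mX := measurable_exray; have X0 := exray_ge0.
have Xge0 y : 0 <= fine (exray y) by rewrite fine_ge0.
pose gp y := Num.max (g y) 0; pose gn y := Num.max (- g y) 0.
have mgp : measurable_fun setT (EFin \o gp).
  by apply/measurable_EFinP; apply: measurable_maxr => //; exact: measurable_cst.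
have mgn : measurable_fun setT (EFin \o gn).
  apply/measurable_EFinP; apply: measurable_maxr; last exact: measurable_cst.
  exact: measurable_funN.
have maxM (a b : R) : 0 <= a -> (Num.max (a * b) 0 = a * Num.max b 0)%R.
  by move=> a0; rewrite maxr_pMr// mulr0.
have part (k : R * R -> R) : measurable_fun setT (EFin \o k) -> (forall y, 0 <= k y) ->
  (\int[mu3]_p (rho (pt3 p) * k (plane_coord p))%:E =
   \int[mu2]_y (xray rho th y.1 y.2 * k y)%:E)%E.
  move=> mk k0.
  under eq_integral do rewrite EFinM.
  rewrite (ge0_integral_exray (EFin \o k))//.
  apply: ge0_ae_eq_integral => //.
  - by apply: emeasurable_funM.
  - apply/measurable_EFinP; apply: measurable_funM; last exact/measurable_EFinP.
    under eq_fun do rewrite xrayE.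
    by apply: measurableT_comp => //; exact: measurable_fine.
  - by move=> y _; rewrite mule_ge0 ?lee_fin.
  - by move=> y _; rewrite lee_fin mulr_ge0// xrayE.
  - apply: filterS exray_ae_fine => y /= /(_ I) e _.
    by rewrite EFinM xrayE -e.
rewrite [LHS]integralE [RHS]integralE; congr (_ - _)%E.
- transitivity (\int[mu3]_p (rho (pt3 p) * gp (plane_coord p))%:E)%E.
    by apply: eq_integral => p _; rewrite funeposE /gp -maxM// EFin_max.
  rewrite part//; last by move=> y; rewrite /gp le_max lexx orbT.
  by apply: eq_integral => y _; rewrite funeposE /gp -maxM ?xrayE// EFin_max.
- transitivity (\int[mu3]_p (rho (pt3 p) * gn (plane_coord p))%:E)%E.
    by apply: eq_integral => p _; rewrite funenegE /gn -maxM// EFin_max mulrN EFinN.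
  rewrite part//; last by move=> y; rewrite /gn le_max lexx orbT.
  by apply: eq_integral => y _; rewrite funenegE /gn -maxM ?xrayE// EFin_max mulrN EFinN.
Qed.

End xray_projection.

(** * The integrand in rotated coordinates and its time derivative *)

Section signal.
Context {R : realType}.
Local Notation mu := (@lebesgue_measure R).
Local Notation mu2 := (mu \x mu)%E.
Local Notation mu3 := (mu2 \x mu)%E.
Variables (rho : 'cV[R]_3 -> R) (th G A1 A2 w1 w2 phi1 phi2 Hsat : R).
Hypothesis rho_ge0 : forall x, 0 <= rho x.
Hypothesis irho : mu3.-integrable setT (fun p => (rho (pt3 p))%:E).
Hypothesis th0pi : 0 <= th < pi.
Hypothesis G0 : G != 0.
Hypothesis Hsat_gt0 : 0 < Hsat.

Let h := Hsat / G.
Let L1 (s : R) := sin (w1 * s + phi1).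
Let L2 (s : R) := sin (w2 * s + phi2).
Let r2 s := A1 * L1 s / G.
Let r3 s := A2 * L2 s / G.

Let h_neq0 : h != 0.
Proof. by rewrite mulf_neq0 ?invr_eq0// gt_eqF. Qed.

Let mrho : measurable_fun setT (fun p : (R * R) * R => rho (pt3 p)).
Proof. by apply/measurable_EFinP; case/integrableP: irho. Qed.

(** The field is G times [E_theta] applied to (0, u1, u2); the entry -1 of [E_theta] absorbs the
    opposite sign of the z component. *)
Lemma HfieldE (p : (R * R) * R) s (i : 'I_3) :
  let u1 := r2 s - (plane_coord th p).1 in
  let u2 := r3 s - (plane_coord th p).2 in
  Hfield th A1 A2 G L1 L2 (pt3 p) s i 0 =
  G * (E_theta th i 1 * u1 + E_theta th i ord_max * u2).
Proof.
rewrite /Hfield /dot3 !big_ord_recl !big_ord0 /r2 /r3 !mxE /=.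
by case: i => -[|[|[|//]]] /= _; field.
Qed.

Lemma norm3_HfieldE (p : (R * R) * R) s :
  norm3 (Hfield th A1 A2 G L1 L2 (pt3 p) s) =
  `|G| * hypot (r2 s - (plane_coord th p).1) (r3 s - (plane_coord th p).2).
Proof.
rewrite /norm3 /dot3 !big_ord_recl big_ord0 !HfieldE !mxE /=.
set u1 := r2 s - _; set u2 := r3 s - _.
rewrite -[RHS]ger0_norm ?mulr_ge0 ?hypot_ge0// -sqrtr_sqr exprMn.
rewrite real_normK ?num_real// sqr_hypot; congr Num.sqrt.
transitivity (G ^+ 2 * ((cos th ^+ 2 + sin th ^+ 2) * u1 ^+ 2 + u2 ^+ 2)).
  by ring.
by rewrite cos2Dsin2 mul1r.
Qed.

(** If G < 0 then h < 0 too, and the two signs cancel because L is odd. *)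
Lemma langevin_scale (n : R) :
  langevin (`|G| * n / Hsat) / `|G| = langevin (n / h) / G.
Proof.
have e : n / h = G * n / Hsat.
  by rewrite /h; field; rewrite G0 gt_eqF.
rewrite e; have [//|] := ger0P G.
by move=> _; rewrite !mulNr langevinN invrN mulrNN.
Qed.

Let field_comb (i : 'I_3) (a b : R) : R :=
  E_theta th i 1 * core_field h 0 a b
  + E_theta th i ord_max * core_field h 1 a b.

Lemma magn_integrandE (i : 'I_3) s p :
  magn_integrand rho th A1 A2 G Hsat L1 L2 s i (pt3 p) =
  rho (pt3 p) * field_comb i (r2 s - (plane_coord th p).1)
                             (r3 s - (plane_coord th p).2).
Proof.
rewrite /magn_integrand HfieldE norm3_HfieldE.
set u1 := r2 s - _; set u2 := r3 s - _.
rewrite mulf_eq0 normr_eq0 (negbTE G0) /= /field_comb /core_field -/(hypot u1 u2).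
(* On the field-free line both sides take the default value 0. *)
have [n0|n0] := eqVneq (hypot u1 u2) 0; first by rewrite !mulr0 addr0 mulr0.
have -> : langevin (`|G| * hypot u1 u2 / Hsat) =
    `|G| * (langevin (hypot u1 u2 / h) / G).
  by rewrite -langevin_scale [RHS]mulrC divfK// normr_eq0.
by rewrite /=; field; rewrite n0 normr_eq0 G0.
Qed.

Lemma is_derive_drive (A w phi s : R) :
  is_derive s (1 : R) (fun x => A * sin (w * x + phi) / G)
    (A * w * cos (w * s + phi) / G).
Proof.
have -> : (fun x => A * sin (w * x + phi) / G) =
    (A / G) \*: (@sin R \o (w \*: id + cst phi)).
  by apply/funext => x; rewrite /= mulrAC.
apply: is_derive_eq; rewrite !fctE /GRing.scale /= addr0 mulr1; by field.
Qed.

(** With [d3], the components of the velocity of the trajectory. *)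
Let d2 s := A1 * w1 * cos (w1 * s + phi1) / G.
Let d3 s := A2 * w2 * cos (w2 * s + phi2) / G.

Let dfield (k : 'I_2) (a b s : R) : R :=
  core_jacobian h k ord0 a b * d2 s + core_jacobian h k ord_max a b * d3 s.

Let dfield_comb (i : 'I_3) (a b s : R) : R :=
  E_theta th i 1 * dfield 0 a b s + E_theta th i ord_max * dfield 1 a b s.

Let is_derive_integrand (i : 'I_3) p s :
  is_derive s (1 : R)
    (fun x => magn_integrand rho th A1 A2 G Hsat L1 L2 x i (pt3 p))
    (rho (pt3 p) * dfield_comb i (r2 s - (plane_coord th p).1)
                                 (r3 s - (plane_coord th p).2) s).
Proof.
under eq_fun do rewrite magn_integrandE.
have D2 : is_derive s (1 : R) (r2 - cst (plane_coord th p).1) (d2 s).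
  by have H := is_derive_drive A1 w1 phi1 s; apply: is_derive_eq; rewrite subr0.
have D3 : is_derive s (1 : R) (r3 - cst (plane_coord th p).2) (d3 s).
  by have H := is_derive_drive A2 w2 phi2 s; apply: is_derive_eq; rewrite subr0.
have H0 := is_derive_core_field h 0 _ _ _ _ _ h_neq0 D2 D3.
have H1 := is_derive_core_field h 1 _ _ _ _ _ h_neq0 D2 D3.
pose F k x := core_field h k ((r2 - cst (plane_coord th p).1) x)
  ((r3 - cst (plane_coord th p).2) x).
have -> : (fun x => rho (pt3 p) * field_comb i (r2 x - (plane_coord th p).1)
                                 (r3 x - (plane_coord th p).2)) =
  rho (pt3 p) \*: (E_theta th i 1 \*: F 0 + E_theta th i ord_max \*: F 1) by [].
by apply: is_derive_eq.
Qed.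

(** Uniform in space and time, so that [C i] times the density is an integrable majorant of the time
    derivative. *)
Let C (i : 'I_3) : R :=
  (`|E_theta th i 1| + `|E_theta th i ord_max|) *
  (3 / `|h| * (`|A1 * w1 / G| + `|A2 * w2 / G|)).

Let drive_bound (A w phi s : R) :
  `|A * w * cos (w * s + phi) / G| <= `|A * w / G|.
Proof.
rewrite mulrAC normrM -[leRHS]mulr1 ler_wpM2l//.
by rewrite ler_norml cos_geN1 cos_le1.
Qed.

Let dfield_bound k a b s :
  `|dfield k a b s| <= 3 / `|h| * (`|A1 * w1 / G| + `|A2 * w2 / G|).
Proof.
apply: le_trans (ler_normD _ _) _; rewrite mulrDr.
by apply: lerD; rewrite normrM; apply: ler_pM => //;
  by [exact: core_jacobian_norm_le|exact: drive_bound].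
Qed.

Let dfield_comb_bound i a b s : `|dfield_comb i a b s| <= C i.
Proof.
apply: le_trans (ler_normD _ _) _; rewrite /C mulrDl.
by apply: lerD; rewrite normrM ler_wpM2l// dfield_bound.
Qed.

Let field_comb_bound i a b :
  `|field_comb i a b| <= `|E_theta th i 1| + `|E_theta th i ord_max|.
Proof.
apply: le_trans (ler_normD _ _) _; rewrite !normrM.
by apply: lerD; rewrite -[leRHS]mulr1 ler_wpM2l// core_field_norm_le1.
Qed.

Let integrable_rhoM (g : (R * R) * R -> R) (B : R) :
  measurable_fun setT g -> (forall p, `|g p| <= B) ->
  mu3.-integrable setT (EFin \o (fun p => rho (pt3 p) * g p)).
Proof.
move=> mg gB.
have iB : mu3.-integrable setT (fun p => B%:E * (rho (pt3 p))%:E)%E.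
  exact: integrableZl.
apply: le_integrable iB => //.
  by apply/measurable_EFinP; exact: measurable_funM.
move=> p _ /=; rewrite lee_fin !normrM mulrC ler_wpM2r//.
by apply: le_trans (gB p) _; rewrite ler_norm.
Qed.

Let mcoord s : measurable_fun setT (fun p => r2 s - (plane_coord th p).1) /\
  measurable_fun setT (fun p => r3 s - (plane_coord th p).2).
Proof.
by split; (apply: measurable_funB; [exact: measurable_cst|]);
  apply: measurableT_comp => //; exact: measurable_plane_coord.
Qed.

Let mjac s k j : measurable_fun setT (fun p =>
  core_jacobian h k j (r2 s - (plane_coord th p).1) (r3 s - (plane_coord th p).2)).
Proof. by have [m2 m3] := mcoord s; exact: measurable_core_jacobian. Qed.

Let integrable_magn i s : mu3.-integrable setT
  (EFin \o (fun p => magn_integrand rho th A1 A2 G Hsat L1 L2 s i (pt3 p))).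
Proof.
under eq_fun do rewrite magn_integrandE.
apply: (@integrable_rhoM _ (`|E_theta th i 1| + `|E_theta th i ord_max|)) => //.
have [m2 m3] := mcoord s.
by apply: measurable_funD; apply: measurable_funM;
  [exact: measurable_cst|exact: measurable_core_field|
   exact: measurable_cst|exact: measurable_core_field].
Qed.

(** The Jacobian depends on the plane coordinates only, so [Rintegral_xray] turns the space integral
    into one over the plane. *)
Let integral_jac s k j :
  \int[mu3]_p (rho (pt3 p) * core_jacobian h k j
     (r2 s - (plane_coord th p).1) (r3 s - (plane_coord th p).2)) =
  core_op h (xray rho th) (r2 s) (r3 s) k j.
Proof.
rewrite (Rintegral_xray rho th rho_ge0 mrho th0pi irho
  (fun y => core_jacobian h k j (r2 s - y.1) (r3 s - y.2))); last first.
  by apply: measurable_core_jacobian; apply: measurable_funB => //; exact: measurable_cst.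
rewrite mxE; apply: eq_Rintegral => y _.
by rewrite core_jacE.
Qed.

(** Differentiation under the integral sign by domination; the derivative then splits by linearity
    into entries of the core operator. *)
Lemma is_derive_magn_int (i : 'I_3) t :
  let A := core_op h (xray rho th) (r2 t) (r3 t) in
  is_derive t (1 : R) (magn_int rho th A1 A2 G Hsat L1 L2 i)
    (E_theta th i 1 * (A 0 0 * d2 t + A 0 1 * d3 t)
     + E_theta th i ord_max * (A 1 0 * d2 t + A 1 1 * d3 t)).
Proof.
move=> A.
pose f s p := magn_integrand rho th A1 A2 G Hsat L1 L2 s i (pt3 p).
pose D p := C i * rho (pt3 p).
(* The radius 1 is arbitrary, since the majorant does not depend on time. *)
have It : (`](t - 1), (t + 1)[%classic : set R) t.
  by rewrite /= in_itv/= ltrBlDr ltrDl ltr01.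
have f_int s : (`](t - 1), (t + 1)[%classic : set R) s ->
  mu3.-integrable setT (EFin \o f s) by move=> _; exact: integrable_magn.
have f_der s p : (`](t - 1), (t + 1)[%classic : set R) s -> setT p ->
    derivable (f ^~ p) s 1.
  by move=> _ _; case: (is_derive_integrand i p s).
have C0 : 0 <= C i by rewrite mulr_ge0// mulr_ge0// ?divr_ge0// addr_ge0.
have D0 p : 0 <= D p by rewrite mulr_ge0.
have D_int : mu3.-integrable setT (EFin \o D).
  rewrite (_ : EFin \o D = (fun p => (C i)%:E * (rho (pt3 p))%:E)%E)//.
  exact: integrableZl.
have dfE s p : partial1of2 f s p = rho (pt3 p) * dfield_comb i
    (r2 s - (plane_coord th p).1) (r3 s - (plane_coord th p).2) s.
  by rewrite partial1of2E; case: (is_derive_integrand i p s).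
have f_ub s p : (`](t - 1), (t + 1)[%classic : set R) s -> setT p ->
    `|partial1of2 f s p| <= D p.
  move=> _ _; rewrite dfE normrM ger0_norm// /D mulrC.
  by rewrite ler_wpM2r// dfield_comb_bound.
have dF := @derivable_under_integral R _ _ mu3 f setT measurableT t _ _ It
  f_int f_der D D0 D_int f_ub.
have eF := @differentiation_under_integral R _ _ mu3 f setT measurableT t _ _ It
  f_int f_der D D0 D_int f_ub.
apply: DeriveDef => //; rewrite -derive1E [LHS]eF.
under eq_Rintegral do rewrite dfE.
pose J k j p := rho (pt3 p) * core_jacobian h k j
    (r2 t - (plane_coord th p).1) (r3 t - (plane_coord th p).2).
have iJ k j : mu3.-integrable setT (EFin \o J k j).
  apply: (@integrable_rhoM _ (3 / `|h|)); first exact: mjac.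
  by move=> p; exact: core_jacobian_norm_le.
have iZ (c : R) k j : mu3.-integrable setT (EFin \o (fun p => c * J k j p)).
  rewrite (_ : EFin \o _ = (fun p => c%:E * (EFin \o J k j) p)%E)//.
  exact: integrableZl.
pose e1 := E_theta th i 1; pose e2 := E_theta th i ord_max.
(* One summand for each entry of the 2 x 2 matrix, with coefficients constant in space. *)
transitivity (\int[mu3]_p ((e1 * d2 t * J 0 ord0 p + e1 * d3 t * J 0 ord_max p)
   + (e2 * d2 t * J 1 ord0 p + e2 * d3 t * J 1 ord_max p))).
  by apply: eq_Rintegral => p _; rewrite /J /dfield_comb /dfield -/e1 -/e2; ring.
have iD (a b : (R * R) * R -> R) : mu3.-integrable setT (EFin \o a) ->
    mu3.-integrable setT (EFin \o b) ->
    mu3.-integrable setT (EFin \o (fun p => a p + b p)).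
  move=> ia ib.
  rewrite (_ : EFin \o _ = ((EFin \o a) \+ (EFin \o b))%E)//.
  exact: integrableD.
rewrite !RintegralD// ?RintegralZl//; try exact: iD.
rewrite !integral_jac -/A -/e1 -/e2.
have -> : (1 : 'I_2) = ord_max by exact/val_inj.
have -> : (0 : 'I_2) = ord0 by exact/val_inj.
by ring.
Qed.

End signal.

(** * The signal equation in matrix form *)

Theorem theorem3p2 (R : realType) (Omega : set 'cV[R]_3)
  (rho : 'cV[R]_3 -> R) (P : 'M[R]_3)
  (th G A1 A2 w1 w2 phi1 phi2 mu0 m Hsat : R) (L1 L2 : R -> R) (t : R) :
  Omega !=set0 -> open Omega -> convex_set3 Omega ->
  (forall x, 0 <= rho x) -> (forall x, ~ Omega x -> rho x = 0) ->
  (@leb3 R).-integrable setT (fun p => (rho (pt3 p) ^+ 2)%:E) ->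
  (@leb3 R).-integrable setT (fun p => (rho (pt3 p))%:E) ->
  0 <= th < pi -> G != 0 ->
  L1 = (fun s => sin (w1 * s + phi1)) ->
  L2 = (fun s => sin (w2 * s + phi2)) ->
  0 < mu0 -> 0 < m -> 0 < Hsat ->
  let h := Hsat / G in
  let r2 := fun s => A1 * L1 s / G in
  let r3 := fun s => A2 * L2 s / G in
  let v : 'cV[R]_2 := \col_(i < 2) [:: derive1 r2 t; derive1 r3 t]`_i in
  let S := magn_int rho th A1 A2 G Hsat L1 L2 in
  (forall i : 'I_3, derivable (S i) t 1) /\
  - (mu0 * m) *: (P *m \col_(i < 3) derive1 (S i) t)
  = - (mu0 * m) *: (P *m (E_theta th *m
        embed_plane (core_op h (xray rho th) (r2 t) (r3 t) *m v))).
Proof.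
move=> _ _ _ rho0 _ _ irho th0pi G0 -> -> _ _ Hsat0 h r2 r3 v S.
have DS i : is_derive t (1 : R) (S i) _ :=
  @is_derive_magn_int R rho th G A1 A2 w1 w2 phi1 phi2 Hsat rho0 irho th0pi G0
    Hsat0 i t.
split=> [i|]; first by case: (DS i).
congr (_ *: (P *m _)); apply/colP => i.
have D2 := @is_derive_drive R G G0 A1 w1 phi1 t.
have D3 := @is_derive_drive R G G0 A2 w2 phi2 t.
have e2 : derive1 r2 t = A1 * w1 * cos (w1 * t + phi1) / G.
  by rewrite derive1E; case: D2.
have e3 : derive1 r3 t = A2 * w2 * cos (w2 * t + phi2) / G.
  by rewrite derive1E; case: D3.
rewrite [LHS]mxE derive1E.
have [_ ->] := DS i.
set B := core_op _ _ _ _.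
have Bv k : (B *m v) k 0 = B k 0 * derive1 r2 t + B k 1 * derive1 r3 t.
  rewrite mxE !big_ord_recl big_ord0 addr0 [v _ _]mxE [v _ _]mxE /=.
  by congr (_ + B k _ * _); exact/val_inj.
(* The first column of [E_theta] meets the zero component of the embedded vector, so only the other
   two columns remain. *)
rewrite [RHS]mxE !big_ord_recl big_ord0 addr0 [embed_plane _ _ _]mxE.
rewrite [embed_plane _ _ _]mxE [embed_plane _ _ _]mxE /= mulr0 add0r !Bv e2 e3.
by congr (E_theta th i _ * _ + E_theta th i _ * _); exact/val_inj.
Qed.
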